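(* Let $n\ge 3$. There exists a subset $\mathcal{A}\subseteq \mathbb{Z}^n_{\mathrm{prim}}$ with $$\lim_{R\to\infty}\frac{\#(\mathcal{A}\cap B_R)}{\#(\mathbb{Z}^n_{\mathrm{prim}}\cap B_R)}=1,$$ where $B_R=\{v\in\mathbb{R}^n:\|v\|\le R\}$, such that for every sequence $\{v_m\}\subset\mathcal{A}$ with $\|v_m\|\to\infty$, the quotients $\|w_{v_m}\|/\|v_m\|$ tend to zero as $m\to\infty$.
   Context: $\|\cdot\|$ is the Euclidean norm on $\mathbb{R}^n$. A vector $v=(a_1,\dots,a_n)\in\mathbb{Z}^n$ is primitive if $\gcd(a_1,\dots,a_n)=1$; $\mathbb{Z}^n_{\mathrm{prim}}$ is the set of primitive vectors. For primitive $v$, $w_v\in\mathbb{Z}^n$ denotes a solution of minimal Euclidean norm of the gcd equation $a_1x_1+\cdots+a_nx_n=1$ in integers $x_1,\dots,x_n$ (its norm $\|w_v\|$ is well defined). *)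

(* Defs.v *)
From HB Require Import structures.
From mathcomp Require Import all_boot all_order all_algebra archimedean.
From mathcomp Require Import finmap.
From mathcomp Require Import all_classical all_reals all_analysis.

Set Implicit Arguments.
Unset Strict Implicit.
Unset Printing Implicit Defensive.

Import Order.TTheory GRing.Theory Num.Theory.
Import numFieldNormedType.Exports.

Local Open Scope classical_set_scope.
Local Open Scope ring_scope.

(* The library's norm [`|v|] on ['rV[R]_n] is the sup norm, hence this one. *)
Definition enorm (R : realType) (n : nat) (v : 'rV[R]_n) : R :=
  Num.sqrt (\sum_(i < n) v 0 i ^+ 2).

Definition ball_origin (R : realType) (n : nat) (r : R) : set 'rV[R]_n :=
  [set v : 'rV[R]_n | enorm v <= r].

Definition toR (R : realType) (n : nat) (v : 'rV[int]_n) : 'rV[R]_n :=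
  map_mx intr v.

Definition primitive (n : nat) : set 'rV[int]_n :=
  [set v : 'rV[int]_n | \big[gcdn/0%N]_(i < n) `|v 0%R i|%N = 1%N].

Definition gcd_solution (n : nat) (v x : 'rV[int]_n) : Prop :=
  \sum_(i < n) v 0 i * x 0 i = 1.

Definition minimal_solution (R : realType) (n : nat) (v w : 'rV[int]_n) : Prop :=
  gcd_solution v w /\
  forall x : 'rV[int]_n, gcd_solution v x -> enorm (toR R w) <= enorm (toR R x).

(* A chosen minimal solution w_v; the junk value 0 is never taken when v is
   primitive, by [minsolP], and all choices have the same norm. *)
Definition minsol (R : realType) (n : nat) (v : 'rV[int]_n) : 'rV[int]_n :=
  xget 0 [set w | minimal_solution R v w].

(* #(A `&` B_r). The cardinal of [fset_set] is meaningful only for finite sets,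
   which is the case here by [finite_ball]. *)
Definition card_ball (R : realType) (n : nat) (A : set 'rV[int]_n) (r : R) : nat :=
  #|` fset_set (A `&` toR R (n:=n) @^-1` ball_origin r) |%fset.

Lemma enorm_toR (R : realType) (n : nat) (v : 'rV[int]_n) :
  enorm (toR R v) = Num.sqrt ((\sum_(i < n) `|v 0%R i|%N ^ 2)%N%:R).
Proof.
rewrite /enorm natr_sum; congr Num.sqrt; apply: eq_bigr => i _.
by rewrite mxE natrX natr_absz intr_norm real_normK // num_real.
Qed.

Lemma bezout_big (n : nat) (f : 'I_n -> int) :
  exists x : 'I_n -> int,
    \sum_(i < n) f i * x i = (\big[gcdn/0%N]_(i < n) `|f i|%N)%:Z.
Proof.
elim: n f => [|n IH] f; first by exists (fun=> 0); rewrite !big_ord0.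
have [x xE] := IH (fun i => f (lift ord0 i)).
pose g := \big[gcdn/0%N]_(i < n) `|f (lift ord0 i)|%N; rewrite -/g in xE.
have -> : \big[gcdn/0%N]_(i < n.+1) `|f i|%N = gcdn `|f ord0|%N g.
  by rewrite big_ord_recl.
have [u [t utE]] := Bezoutz (f ord0) g%:Z; rewrite /gcdz absz_nat in utE.
exists (fun i => if unlift ord0 i is Some j then t * x j else u).
rewrite big_ord_recl unlift_none.
under eq_bigr => i _ do rewrite liftK mulrCA.
by rewrite -mulr_sumr xE mulrC utE.
Qed.

Lemma minsolP (R : realType) (n : nat) (v : 'rV[int]_n) :
  primitive v -> minimal_solution R v (minsol R v).
Proof.
move=> pv; rewrite /minsol.
apply: (@xgetPex _ 0 [set w | minimal_solution R v w]).
pose N (w : 'rV[int]_n) := (\sum_(i < n) `|w 0%R i|%N ^ 2)%N.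
pose P k := `[< exists2 w, gcd_solution v w & N w = k >].
have exP : exists k, P k.
  have [x xE] := bezout_big (fun i => v 0 i).
  exists (N (\row_i x i)); apply/asboolP; exists (\row_i x i) => //.
  rewrite /gcd_solution; under eq_bigr do rewrite mxE.
  by rewrite xE pv.
case: (ex_minnP exP) => k /asboolP[w vw Nw] kmin.
exists w; split => // x vx; rewrite !enorm_toR ler_wsqrtr// ler_nat.
by rewrite -/(N w) Nw; apply: kmin; apply/asboolP; exists x.
Qed.

Lemma finite_ball (R : realType) (n : nat) (r : R) :
  finite_set (toR R (n:=n) @^-1` ball_origin r).
Proof.
pose k := Num.truncn r.
pose f (m : 'rV['I_(k + k).+1]_n) : 'rV[int]_n :=
  map_mx (fun j : 'I_(k + k).+1 => j%:Z - k%:Z) m.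
apply: (@sub_finite_set _ _ (f @` [set: 'rV['I_(k + k).+1]_n])); last first.
  by apply: finite_image; exact: finite_finset.
move=> v /=; rewrite /ball_origin /= => vr.
have vk i : (`|v 0%R i| <= k)%N.
  rewrite /k truncn_ge_nat; last exact: le_trans (sqrtr_ge0 _) vr.
  apply: le_trans vr; rewrite natr_absz intr_norm -sqrtr_sqr ler_wsqrtr//.
  rewrite (bigD1 i)//= mxE lerDl sumr_ge0// => j _; exact: sqr_ge0.
exists (\row_i inord (absz (v 0 i + k%:Z))) => //.
apply/rowP => i; rewrite !mxE.
have := vk i; case: (v 0 i) => m vm.
  have -> : absz (m%:Z + k%:Z) = (m + k)%N by [].
  rewrite inordK; first by rewrite PoszD addrK.
  by rewrite ltnS /= leq_add2r.
have -> : Negz m + k%:Z = (k - m.+1)%N%:Z.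
  by rewrite NegzE addrC subzn.
rewrite inordK; first by rewrite NegzE -subzn// addrAC subrr add0r.
by rewrite ltnS /= (leq_trans (leq_subr _ _))// leq_addr.
Qed.

(* Main.v *)
(**
If no nonzero integer relation u.v = 0 has height at most K, then the gcd
equation of v has a solution of norm O(1 + |v|/K). Indeed, for each triple
(v_i, v_k, v_l) with v_i <> 0, Gauss reduction of the rank two lattice of its
relations gives p, q with p x q = (v_i, v_k, v_l) and |p|^2 |q|^2 <= 4/3 |p x q|^2,
hence |p|, |q| = O(|v|/K). The vector v_i e_k - v_k e_i is an integer
combination of p and q, so these relations span the hyperplane orthogonal to v
when k varies, and any solution can be rounded along them to a short one.

Relations of height at most D define at most (2D+1)^n hyperplanes, each with at
most (2N+1)^(n-1) points of height at most N, while a positive proportion of the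
points of the ball are primitive. With D of order N^(1/2n) this is negligible,
and A is the set of primitive v whose relations u <> 0 all have height at
least |v|^(1/2n).
*)
Require Import Defs.
From mathcomp Require Import all_boot all_order all_algebra archimedean.
From mathcomp Require Import zify ring lra.
From mathcomp Require Import finmap.
From mathcomp Require Import all_classical all_reals all_analysis.
Import Order.TTheory GRing.Theory Num.Theory.
Import numFieldNormedType.Exports.
Local Open Scope classical_set_scope.
Local Open Scope ring_scope.

(** * Gauss reduction for the integer relations of a triple *)

Lemma nearest_multiple (x d : int) : 0 < d -> exists t : int, 2 * `|x - t * d| <= d.
Proof.
move=> d0; pose r := (x %% d)%Z; pose m := (x %/ d)%Z.
have xE : x = m * d + r by rewrite /m /r -divz_eq.
have r0 : 0 <= r by rewrite modz_ge0 // gt_eqF.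
have rd : r < d by rewrite ltz_pmod.
have [h|h] := lerP (2 * r) d; [exists m|exists (m + 1)].
  by rewrite xE addrC addKr ger0_norm.
have -> : x - (m + 1) * d = r - d by rewrite xE; ring.
rewrite ler0_norm; lia.
Qed.

Lemma sum3sq_gt0 (x y z : int) :
  (0 < x ^+ 2 + y ^+ 2 + z ^+ 2) = ((x != 0) || (y != 0) || (z != 0)).
Proof.
rewrite lt0r !addr_ge0 ?sqr_ge0 // andbT.
by rewrite !paddr_eq0 ?addr_ge0 ?sqr_ge0 // !sqrf_eq0 !negb_and.
Qed.

Lemma shortest_relation3 (a b c : int) : (a != 0) || (b != 0) || (c != 0) ->
  exists p1 p2 p3 : int,
    [/\ p1 * a + p2 * b + p3 * c = 0, 0 < p1 ^+ 2 + p2 ^+ 2 + p3 ^+ 2 &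
        forall q1 q2 q3 : int, q1 * a + q2 * b + q3 * c = 0 ->
          0 < q1 ^+ 2 + q2 ^+ 2 + q3 ^+ 2 ->
          p1 ^+ 2 + p2 ^+ 2 + p3 ^+ 2 <= q1 ^+ 2 + q2 ^+ 2 + q3 ^+ 2].
Proof.
move=> abc.
pose P m := `[< exists p1 p2 p3 : int, [/\ p1 * a + p2 * b + p3 * c = 0,
  0 < p1 ^+ 2 + p2 ^+ 2 + p3 ^+ 2 & p1 ^+ 2 + p2 ^+ 2 + p3 ^+ 2 = m%:Z] >].
have toP q1 q2 q3 : q1 * a + q2 * b + q3 * c = 0 ->
    0 < q1 ^+ 2 + q2 ^+ 2 + q3 ^+ 2 -> P (absz (q1 ^+ 2 + q2 ^+ 2 + q3 ^+ 2)).
  move=> q0 qgt; apply/asboolP; exists q1, q2, q3; split => //.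
  by rewrite gez0_abs // ltW.
have exP : exists m, P m.
  have [/eqP a0|a0] := boolP (a == 0).
    by eexists; apply: (toP 1 0 0); rewrite ?a0 //; ring.
  by eexists; apply: (toP b (- a) 0); [ring | rewrite sum3sq_gt0 oppr_eq0 a0 orbT].
case: (ex_minnP exP) => m /asboolP[p1 [p2 [p3 [p0 pgt pE]]]] mmin.
exists p1, p2, p3; split => // q1 q2 q3 q0 qgt.
have := mmin _ (toP _ _ _ q0 qgt).
by rewrite pE -lez_nat gez0_abs // ltW.
Qed.

(** Write v = (a, b, c). A shortest relation p is primitive, which yields some q with p x q = v.
    Shifting q by multiples of p keeps p x q and achieves 2|p.q| <= |p|^2 <= |p||q|, so Lagrange's
    identity leaves at least three quarters of |p|^2 |q|^2 to |v|^2. *)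
Lemma reduced_pair3 (a b c : int) : (a != 0) || (b != 0) || (c != 0) ->
  exists p1 p2 p3 q1 q2 q3 : int,
    [/\ [/\ p2 * q3 - p3 * q2 = a, p3 * q1 - p1 * q3 = b & p1 * q2 - p2 * q1 = c],
        p1 ^+ 2 + p2 ^+ 2 + p3 ^+ 2 <= q1 ^+ 2 + q2 ^+ 2 + q3 ^+ 2 &
        3 * ((p1 ^+ 2 + p2 ^+ 2 + p3 ^+ 2) * (q1 ^+ 2 + q2 ^+ 2 + q3 ^+ 2))
          <= 4 * (a ^+ 2 + b ^+ 2 + c ^+ 2)].
Proof.
move=> abc; have [p1 [p2 [p3 [p0 pgt pmin]]]] := shortest_relation3 _ _ _ abc.
(* Minimality makes p primitive: p divided by its gcd g is again a nonzero relation, which forces g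
   = 1, and Bezout provides r with p.r = 1. *)
have [r1 [r2 [r3 rE]]] : exists r1 r2 r3 : int, p1 * r1 + p2 * r2 + p3 * r3 = 1.
  pose g := gcdz (gcdz p1 p2) p3.
  have /dvdzP[s1 s1E] : (g %| p1)%Z by rewrite (dvdz_trans (dvdz_gcdl _ _)) ?dvdz_gcdl.
  have /dvdzP[s2 s2E] : (g %| p2)%Z by rewrite (dvdz_trans (dvdz_gcdl _ _)) ?dvdz_gcdr.
  have /dvdzP[s3 s3E] : (g %| p3)%Z by rewrite dvdz_gcdr.
  have g0 : g != 0.
    by apply: contraTneq pgt => g0; rewrite s1E s2E s3E g0 !mulr0 expr0n.
  have pE : p1 ^+ 2 + p2 ^+ 2 + p3 ^+ 2 = g ^+ 2 * (s1 ^+ 2 + s2 ^+ 2 + s3 ^+ 2).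
    by rewrite s1E s2E s3E; ring.
  have sgt : 0 < s1 ^+ 2 + s2 ^+ 2 + s3 ^+ 2.
    by move: pgt; rewrite pE pmulr_rgt0 // exprn_even_gt0.
  have := pmin s1 s2 s3.
  rewrite pE ger_pMl // => /(_ _ sgt) gle.
  have {}gle : g ^+ 2 <= 1.
    apply: gle; apply: (mulfI g0); rewrite mulr0 -p0 s1E s2E s3E; ring.
  have g1 : g = 1.
    have gge : 0 <= g by rewrite /g /gcdz.
    move: gle; rewrite expr_le1 // => gle.
    by move: gge gle g0; clear; lia.
  have [u [t ut]] := Bezoutz (gcdz p1 p2) p3.
  have [u' [t' ut']] := Bezoutz p1 p2.
  exists (u * u'), (u * t'), t; rewrite -g1 /g -ut -ut'; ring.
(* x = v x r satisfies p x x = v. Subtracting from x the multiple t p nearest to its projection on p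
   gives q. *)
pose x1 := b * r3 - c * r2; pose x2 := c * r1 - a * r3; pose x3 := a * r2 - b * r1.
have [t tE] := nearest_multiple (p1 * x1 + p2 * x2 + p3 * x3) _ pgt.
pose q1 := x1 - t * p1; pose q2 := x2 - t * p2; pose q3 := x3 - t * p3.
(* The next three identities read p x (v x r) = (p.r) v - (p.v) r. *)
have e1 : p2 * q3 - p3 * q2 = a.
  transitivity (a * (p1 * r1 + p2 * r2 + p3 * r3) - r1 * (p1 * a + p2 * b + p3 * c)).
    by rewrite /q2 /q3 /x2 /x3; ring.
  by rewrite rE p0; ring.
have e2 : p3 * q1 - p1 * q3 = b.
  transitivity (b * (p1 * r1 + p2 * r2 + p3 * r3) - r2 * (p1 * a + p2 * b + p3 * c)).
    by rewrite /q1 /q3 /x1 /x3; ring.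
  by rewrite rE p0; ring.
have e3 : p1 * q2 - p2 * q1 = c.
  transitivity (c * (p1 * r1 + p2 * r2 + p3 * r3) - r3 * (p1 * a + p2 * b + p3 * c)).
    by rewrite /q1 /q2 /x1 /x2; ring.
  by rewrite rE p0; ring.
have pq : p1 ^+ 2 + p2 ^+ 2 + p3 ^+ 2 <= q1 ^+ 2 + q2 ^+ 2 + q3 ^+ 2.
  apply: pmin; first by rewrite -e1 -e2 -e3; ring.
  rewrite sum3sq_gt0; apply: contraT; rewrite !negb_or !negbK.
  move=> /andP[/andP[/eqP z1 /eqP z2] /eqP z3].
  by move: abc; rewrite -e1 -e2 -e3 z1 z2 z3 !mulr0 subr0 eqxx.
exists p1, p2, p3, q1, q2, q3; split => //.
set p := p1 ^+ 2 + p2 ^+ 2 + p3 ^+ 2 in pgt tE pq *.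
set q := q1 ^+ 2 + q2 ^+ 2 + q3 ^+ 2 in pq *.
pose s := p1 * q1 + p2 * q2 + p3 * q3.
(* Lagrange's identity |p|^2 |q|^2 = |p x q|^2 + (p.q)^2. *)
have lag : p * q = a ^+ 2 + b ^+ 2 + c ^+ 2 + s ^+ 2.
  by rewrite -e1 -e2 -e3 /p /q /s; ring.
have sp : 2 * `|s| <= p.
  suff -> : s = p1 * x1 + p2 * x2 + p3 * x3 - t * p by [].
  by rewrite /s /q1 /q2 /q3 /p; ring.
have s4 : 4 * s ^+ 2 <= p ^+ 2.
  have -> : 4 * s ^+ 2 = (2 * `|s|) ^+ 2 by rewrite exprMn real_normK ?num_real.
  by rewrite lerXn2r ?nnegrE ?mulr_ge0 // ltW.
have pp : p ^+ 2 <= p * q by rewrite expr2 ler_pM2l.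
move: lag s4 pp; clear.
move: (p * q) (a ^+ 2 + b ^+ 2 + c ^+ 2) (s ^+ 2) (p ^+ 2) => ? ? ? ?; lia.
Qed.

(** * Relations of a vector and their heights *)

Definition height {n : nat} (v : 'rV[int]_n) : nat := \max_(i < n) `|v 0%R i|%N.

Definition relation {n : nat} (v u : 'rV[int]_n) : Prop :=
  \sum_(i < n) v 0 i * u 0 i = 0.

Lemma ler_height (n : nat) (v : 'rV[int]_n) (i : 'I_n) : `|v 0 i| <= (height v)%:Z.
Proof. by rewrite -abszE lez_nat; exact: leq_bigmax. Qed.

Lemma relationD (n : nat) (v u w : 'rV[int]_n) :
  relation v u -> relation v w -> relation v (u + w).
Proof.
rewrite /relation => u0 w0.
under eq_bigr do rewrite mxE mulrDr.
by rewrite big_split /= u0 w0 addr0.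
Qed.

Lemma relationZ (n : nat) (v u : 'rV[int]_n) (c : int) :
  relation v u -> relation v (c *: u).
Proof.
rewrite /relation => u0.
under eq_bigr do rewrite mxE mulrCA.
by rewrite -mulr_sumr u0 mulr0.
Qed.

Lemma sum_mul_delta (n : nat) (v : 'rV[int]_n) (i : 'I_n) (c : int) :
  \sum_(j < n) v 0 j * (c *: delta_mx 0 i : 'rV[int]_n) 0 j = c * v 0 i.
Proof.
rewrite (bigD1 i) //= big1 ?addr0; first by rewrite !mxE !eqxx mulr1 mulrC.
by move=> j ji; rewrite !mxE (negPf ji) andbF !mulr0.
Qed.

Definition row3 {n : nat} (i k l : 'I_n) (x y z : int) : 'rV[int]_n :=
  x *: delta_mx 0 i + y *: delta_mx 0 k + z *: delta_mx 0 l.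

Lemma relation_row3 (n : nat) (v : 'rV[int]_n) (i k l : 'I_n) (x y z : int) :
  x * v 0 i + y * v 0 k + z * v 0 l = 0 -> relation v (row3 i k l x y z).
Proof.
rewrite /relation /row3 => xyz.
under eq_bigr do rewrite mxE mulrDr mxE mulrDr.
by rewrite !big_split /= !sum_mul_delta xyz.
Qed.

Lemma row3_sqr_le (n : nat) (i k l : 'I_n) (x y z : int) (j : 'I_n) :
  i != k -> i != l -> k != l ->
  (row3 i k l x y z 0 j) ^+ 2 <= x ^+ 2 + y ^+ 2 + z ^+ 2.
Proof.
move=> ik il kl; rewrite !mxE eqxx /=.
have [->|ji] := eqVneq j i.
  rewrite (negPf ik) (negPf il) !mulr0 !addr0 mulr1 -addrA lerDl.
  by rewrite addr_ge0 ?sqr_ge0.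
have [->|jk] := eqVneq j k.
  rewrite (negPf kl) !mulr0 add0r addr0 mulr1 addrAC lerDr.
  by rewrite addr_ge0 ?sqr_ge0.
have [_|jl] := eqVneq j l.
  by rewrite !mulr0 !add0r mulr1 lerDr addr_ge0 ?sqr_ge0.
by rewrite !mulr0 !addr0 expr0n !addr_ge0 ?sqr_ge0.
Qed.

Lemma height_gt (n : nat) (v : 'rV[int]_n) (K : nat) :
  (K < height v)%N -> exists i, K%:Z < `|v 0 i|.
Proof.
move=> KV; apply: contrapT => /forallNP h.
move: KV; rewrite ltnNge => /negP; apply; apply/bigmax_leqP => i _.
by have := h i; rewrite -abszE ltz_nat => /negP; rewrite -leqNgt.
Qed.

(** P and Q carry the reduced pair p, q of the triple (v_i, v_k, v_l) at the coordinates i, k, l. As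
    P is a nonzero relation, |p| >= K, so the bound on |p||q| becomes an upper bound for |q|, the
    longer of the two. *)
Lemma short_relations (n : nat) (v : 'rV[int]_n) (i k l : 'I_n) (K : nat) :
  i != k -> i != l -> k != l -> v 0 i != 0 ->
  (forall u, u != 0 -> relation v u -> (K < height u)%N) ->
  exists (P Q : 'rV[int]_n) (x y : int),
    [/\ [/\ relation v P, relation v Q &
            v 0 i *: delta_mx 0 k - v 0 k *: delta_mx 0 i = x *: P + y *: Q],
        forall j, K%:Z * `|P 0 j| <= 2 * (height v)%:Z &
        forall j, K%:Z * `|Q 0 j| <= 2 * (height v)%:Z].
Proof.
move=> ik il kl vi Kv; set V := (height v)%:Z.
have [p1 [p2 [p3 [q1 [q2 [q3 [[e1 e2 e3] pq pqv]]]]]]] :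
    exists p1 p2 p3 q1 q2 q3 : int,
    [/\ [/\ p2 * q3 - p3 * q2 = v 0 i, p3 * q1 - p1 * q3 = v 0 k &
            p1 * q2 - p2 * q1 = v 0 l],
        p1 ^+ 2 + p2 ^+ 2 + p3 ^+ 2 <= q1 ^+ 2 + q2 ^+ 2 + q3 ^+ 2 &
        3 * ((p1 ^+ 2 + p2 ^+ 2 + p3 ^+ 2) * (q1 ^+ 2 + q2 ^+ 2 + q3 ^+ 2))
          <= 4 * (v 0 i ^+ 2 + v 0 k ^+ 2 + v 0 l ^+ 2)].
  by apply: reduced_pair3; rewrite vi.
pose P := row3 i k l p1 p2 p3; pose Q := row3 i k l q1 q2 q3.
have rP : relation v P by apply: relation_row3; rewrite -e1 -e2 -e3; ring.
have rQ : relation v Q by apply: relation_row3; rewrite -e1 -e2 -e3; ring.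
(* This combination cancels coordinate l; its entries at i and k are components of p x q up to
   sign. *)
have id : v 0 i *: delta_mx 0 k - v 0 k *: delta_mx 0 i = q3 *: P + (- p3) *: Q.
  by apply/rowP => j; rewrite !mxE -e1 -e2; ring.
have P0 : P != 0.
  apply: contra_neq vi => P0.
  have := congr1 (fun u : 'rV[int]_n => u 0 k) P0.
  have := congr1 (fun u : 'rV[int]_n => u 0 l) P0.
  have ki : (k == i) = false by rewrite eq_sym (negPf ik).
  have li : (l == i) = false by rewrite eq_sym (negPf il).
  have lk : (l == k) = false by rewrite eq_sym (negPf kl).
  rewrite !mxE !eqxx ki li lk (negPf kl) /= !mulr0 !mulr1 !add0r !addr0 => p30 p20.
  by rewrite -e1 p20 p30 !mul0r subr0.
have [j0 Kj0] := height_gt _ _ _ (Kv P P0 rP).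
set p := p1 ^+ 2 + p2 ^+ 2 + p3 ^+ 2 in pq pqv *.
set q := q1 ^+ 2 + q2 ^+ 2 + q3 ^+ 2 in pq pqv *.
have Kp : K%:Z ^+ 2 <= p.
  apply: le_trans (row3_sqr_le n i k l p1 p2 p3 j0 ik il kl).
  by rewrite -[leRHS]real_normK ?num_real // lerXn2r ?nnegrE // ltW.
have vV j : v 0 j ^+ 2 <= V ^+ 2.
  by rewrite -[leLHS]real_normK ?num_real // lerXn2r ?nnegrE // ler_height.
have q0 : 0 <= q by rewrite !addr_ge0 ?sqr_ge0.
(* The factor 4 is 4/3 from the reduction times 3 for the squares of three entries of v, each at
   most V^2. *)
have KqV : K%:Z ^+ 2 * q <= 4 * V ^+ 2.
  have : K%:Z ^+ 2 * q <= p * q by rewrite ler_wpM2r.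
  move: (vV i) (vV k) (vV l) pqv; clear.
  move: (K%:Z ^+ 2 * q) (p * q) (v 0 i ^+ 2) (v 0 k ^+ 2) (v 0 l ^+ 2) (V ^+ 2).
  move=> ? ? ? ? ? ?; lia.
have bound (x : int) : x ^+ 2 <= q -> K%:Z * `|x| <= 2 * V.
  move=> xq; rewrite -(@ler_pXn2r _ 2) ?nnegrE ?mulr_ge0 //.
  rewrite !exprMn real_normK ?num_real //.
  by apply: le_trans KqV; rewrite ler_wpM2l ?sqr_ge0.
exists P, Q, q3, (- p3); split=> // j; apply: bound.
  by apply: le_trans pq; exact: row3_sqr_le.
exact: row3_sqr_le.
Qed.

(** * Rounding a solution of the gcd equation to a short one *)

Lemma third_index (n : nat) (i k : 'I_n) : (3 <= n)%N ->
  exists l : 'I_n, (i != l) && (k != l).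
Proof.
move=> n3; have [l lik] : exists l, l \in ~: [set i; k]%SET.
  apply/set0Pn; rewrite -card_gt0 cardsCs finset.setCK card_ord subn_gt0.
  by rewrite (leq_ltn_trans _ n3) // cards2; case: (i != k).
by exists l; move: lik; rewrite !inE negb_or (eq_sym l i) (eq_sym l k).
Qed.

(** With a = v_i nonzero, [a *: w0] is e_i plus a combination of the short relations P_k, Q_k.
    Subtracting from w0 the relations with the quotients of the coefficients by a gives a solution w
    for which only remainders, smaller than |a|, are left in [a *: w]. *)
Lemma short_solution (n : nat) (v w0 : 'rV[int]_n) (K : nat) :
  (3 <= n)%N -> gcd_solution v w0 ->
  (forall u, u != 0 -> relation v u -> (K < height u)%N) ->
  exists w, gcd_solution v w /\
    forall j, K%:Z * `|w 0 j| <= K%:Z + 4 * n%:Z * (height v)%:Z.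
Proof.
move=> n3 vw0 Kv; set V := (height v)%:Z.
have [i vi] : exists i, v 0 i != 0.
  apply: contrapT => /forallNP v0; move: vw0; rewrite /gcd_solution big1 // => j _.
  by have /negP := v0 j; rewrite negbK => /eqP ->; rewrite mul0r.
set a := v 0 i in vi.
have /choice[P /choice[Q /choice[x /choice[y H]]]] k :
  exists (P Q : 'rV[int]_n) (x y : int),
    [/\ [/\ relation v P, relation v Q &
            a *: delta_mx 0 k - v 0 k *: delta_mx 0 i = x *: P + y *: Q],
        forall j, K%:Z * `|P 0 j| <= 2 * V &
        forall j, K%:Z * `|Q 0 j| <= 2 * V].
  (* For k = i the vector to decompose is zero, and zero relations do. *)
  have [->|ki] := eqVneq k i.
    exists 0, 0, 0, 0.
    have r0 : relation v 0 by rewrite /relation big1 // => j _; rewrite mxE mulr0.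
    split; [split => // | |].
    - by rewrite subrr !scaler0 addr0.
    - by move=> j; rewrite mxE normr0 mulr0 mulr_ge0.
    - by move=> j; rewrite mxE normr0 mulr0 mulr_ge0.
  (* Here n >= 3 matters: a third coordinate makes the relations of the triple a lattice of rank
     two. *)
  have [l /andP[il kl]] := third_index n i k n3.
  by apply: (short_relations n v i k l K) => //; rewrite eq_sym.
pose m k := ((w0 0%R k * x k)%R %/ a)%Z; pose m' k := ((w0 0%R k * y k)%R %/ a)%Z.
pose r k := ((w0 0%R k * x k)%R %% a)%Z; pose r' k := ((w0 0%R k * y k)%R %% a)%Z.
pose w := w0 - \sum_k (m k *: P k + m' k *: Q k).
(* Writing [a *: w0] through the short relations and keeping only the
   remainders modulo [a] of the coefficients gives [a *: w]. *)
have aw0 : a *: w0 = delta_mx 0 i + \sum_k w0 0 k *: (x k *: P k + y k *: Q k).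
  apply/rowP => j; rewrite !mxE eqxx /= summxE.
  have -> : \sum_k (w0 0 k *: (x k *: P k + y k *: Q k)) 0 j =
    \sum_k (a * (w0 0 k * (j == k)%:R) - (j == i)%:R * (v 0 k * w0 0 k)).
    by apply: eq_bigr => k _; have [[_ _ <-] _ _] := H k; rewrite !mxE eqxx /=; ring.
  rewrite sumrB -!mulr_sumr vw0 (bigD1 j) //= eqxx big1 ?addr0; last first.
    by move=> k kj; rewrite eq_sym (negPf kj) mulr0.
  by rewrite mulr1 [_%:R * 1]mulr1; ring.
have aw : a *: w = delta_mx 0 i + \sum_k (r k *: P k + r' k *: Q k).
  rewrite /w scalerBr aw0 -addrA scaler_sumr -sumrB; congr (_ + _).
  apply: eq_bigr => k _.
  have e1 : w0 0 k * x k = m k * a + r k by rewrite /m /r -divz_eq.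
  have e2 : w0 0 k * y k = m' k * a + r' k by rewrite /m' /r' -divz_eq.
  apply/rowP => j; rewrite !mxE mulrDr !mulrA e1 e2; ring.
exists w; split.
  rewrite /gcd_solution /w; under eq_bigr do rewrite mxE mulrDr.
  rewrite big_split /= vw0 -[RHS]addr0; congr (_ + _).
  rewrite -scaleN1r; apply: relationZ.
  apply: (big_ind (relation v)) => [|u u'|k _].
  - by rewrite /relation big1 // => j _; rewrite mxE mulr0.
  - exact: relationD.
  - by have [[rP rQ _] _ _] := H k; apply: relationD; exact: relationZ.
(* The bound is proved multiplied by |a|: e_i accounts for the term K, and each k contributes
   K(|P_k| + |Q_k|) <= 4V. *)
move=> j; rewrite -(@ler_pM2l _ `|a|) ?normr_gt0 // mulrCA -normrM.
have -> : a * w 0 j = (a *: w) 0 j by rewrite [RHS]mxE.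
rewrite aw mxE summxE; apply: le_trans (_ : K%:Z * (1 + \sum_k `|a| * (`|P k 0 j| + `|Q k 0 j|)) <= _).
  rewrite ler_wpM2l // (le_trans (ler_normD _ _)) // lerD //.
    by rewrite mxE; case: (_ && _).
  apply: le_trans (ler_norm_sum _ _ _) _; apply: ler_sum => k _.
  rewrite !mxE (le_trans (ler_normD _ _)) // !normrM mulrDr.
  by rewrite lerD // ler_wpM2r // ger0_norm ?modz_ge0 // ltW // ltz_mod.
rewrite !mulrDr mulr1 lerD //.
  by rewrite -[leLHS]mul1r ler_wpM2r // -gtz0_ge1 normr_gt0.
rewrite mulr_sumr.
have -> : `|a| * (4 * n%:Z * V) = \sum_(k < n) `|a| * (4 * V).
  by rewrite sumr_const card_ord -mulr_natr natz; ring.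
apply: ler_sum => k _; rewrite mulrCA ler_wpM2l // mulrDr.
have [_ PV QV] := H k; move: (PV j) (QV j); clear.
move: (K%:Z * _) (K%:Z * _) => ? ?; lia.
Qed.

(** * Counting the vectors that have a relation of small height *)

Lemma leq_card_fset_set_image (T : finType) (X : choiceType) (B : {set T})
    (g : T -> X) (S : set X) : finite_set S ->
  (forall x, S x -> exists2 t, t \in B & g t = x) ->
  (#|` fset_set S|%fset <= #|B|)%N.
Proof.
move=> finS Sg; rewrite cardE -(size_map g).
apply: uniq_leq_size; first exact: fset_uniq.
move=> x; rewrite in_fset_set // inE => /Sg[t tB <-].
by apply: map_f; rewrite mem_enum.
Qed.

Lemma leq_card_fset_set_inj (T : finType) (X : choiceType) (B : {set T})
    (g : T -> X) (S : set X) : finite_set S -> injective g ->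
  (forall t, t \in B -> S (g t)) -> (#|B| <= #|` fset_set S|%fset)%N.
Proof.
move=> finS ginj BS; rewrite cardE -(size_map g).
apply: uniq_leq_size; first by rewrite map_inj_uniq ?enum_uniq.
move=> x /mapP[t]; rewrite mem_enum => tB ->.
by rewrite in_fset_set // inE; exact: BS.
Qed.

(** Shifting the ordinals 0..2N to -N..N parametrizes the vectors of height at most N by a finite
    type, where cardinals can be computed. *)
Definition box (n N : nat) (m : 'rV['I_(N + N).+1]_n) : 'rV[int]_n :=
  map_mx (fun j : 'I_(N + N).+1 => j%:Z - N%:Z) m.

Lemma box_inj (n N : nat) : injective (box n N).
Proof.
move=> m m' /rowP mm'; apply/rowP => i; apply/val_inj.
by have := mm' i; rewrite !mxE => /addIr[].
Qed.

Lemma box_surj (n N : nat) (v : 'rV[int]_n) :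
  (height v <= N)%N -> exists m, box n N m = v.
Proof.
move=> vN; exists (\row_i inord (absz (v 0 i + N%:Z))).
apply/rowP => i; rewrite !mxE.
have : `|v 0 i| <= N%:Z by rewrite (le_trans (ler_height n v i)) // lez_nat.
move: (v 0 i) => x xN.
have x0 : 0 <= x + N%:Z by lia.
by rewrite inordK ?gez0_abs //; lia.
Qed.

(** If u_k is nonzero, the equation determines coordinate k from the others, so deleting column k is
    injective on the solutions. *)
Lemma card_relation_box (n N : nat) (u : 'rV[int]_n) : u != 0 ->
  (#|[set m : 'rV['I_(N + N).+1]_n | (\sum_i box n N m 0 i * u 0 i == 0)%R]%SET|
    <= (N + N).+1 ^ n.-1)%N.
Proof.
move=> u0; have [k uk] : exists k, u 0 k != 0.
  apply: contrapT => /forallNP uz; move/eqP: u0; apply; apply/rowP => k.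
  by rewrite mxE; apply: contrapT => /eqP; exact: uz.
rewrite -(@card_in_imset _ _ (col' k)); last first.
  move=> m m'; rewrite !inE => /eqP mu /eqP m'u /rowP mm'.
  have eqm j : j != k -> m 0 j = m' 0 j.
    by rewrite eq_sym => /unlift_some[j' -> _]; have := mm' j'; rewrite !mxE.
  apply/(box_inj n N)/rowP => j; have [->|jk] := eqVneq j k; last first.
    by rewrite !mxE eqm.
  apply: (mulIf uk); move: (etrans mu (esym m'u)); rewrite (bigD1 k) //= [in RHS](bigD1 k) //=.
  rewrite (eq_bigr (fun i => box n N m' 0 i * u 0 i)); first exact: addIr.
  by move=> i ik; rewrite !mxE eqm.
by rewrite (leq_trans (max_card _)) // card_mx mul1n card_ord.
Qed.

Definition related (n N D : nat) : set 'rV[int]_n :=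
  [set v | (height v <= N)%N /\
    exists u, [/\ u != 0, relation v u & (height u <= D)%N]].

Lemma card_related (n N D : nat) (S : set 'rV[int]_n) :
  finite_set S -> S `<=` related n N D ->
  (#|` fset_set S|%fset <= (D + D).+1 ^ n * (N + N).+1 ^ n.-1)%N.
Proof.
move=> finS Srel.
pose B (m' : 'rV['I_(D + D).+1]_n) := [set m : 'rV['I_(N + N).+1]_n |
  (\sum_i box n N m 0 i * box n D m' 0 i == 0)%R]%SET.
apply: (@leq_trans #|(\bigcup_(m' | box n D m' != 0%R) B m')%SET|).
  apply: (leq_card_fset_set_image _ _ _ (box n N)) => // v /Srel[vN].
  move=> [u [u0 vu uD]].
  have [m mv] := box_surj n N v vN; have [m' m'u] := box_surj n D u uD.
  exists m => //; apply/bigcupP; exists m'; rewrite ?m'u //.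
  by rewrite inE mv m'u; apply/eqP.
apply: leq_trans (unstable.card_big_setU _ _ _) _.
apply: (@leq_trans (\sum_(m' | box n D m' != 0%R) (N + N).+1 ^ n.-1)%N).
  by apply: leq_sum => m' m'0; exact: card_relation_box.
by rewrite sum_nat_const leq_mul2r (leq_trans (max_card _)) ?orbT // card_mx mul1n card_ord.
Qed.

(** * A positive proportion of the vectors is primitive *)

Definition pos_row (n M : nat) (t : {ffun 'I_n -> 'I_M}) : 'rV[int]_n :=
  \row_i (t i).+1%:Z.

Lemma pos_row_inj (n M : nat) : injective (pos_row n M).
Proof.
move=> t t' /rowP tt'; apply/ffunP => i; apply/val_inj.
by have := tt' i; rewrite !mxE => -[].
Qed.

(** Telescoping: 1/(x+1)^2 <= 1/x - 1/(x+1), started at d = 2, where equality holds. What matters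
    later is that 3/4 is below 1. *)
Lemma sum_inv_sqr_le (R : realFieldType) (M : nat) :
  \sum_(2 <= d < M.+3) (d%:R ^+ 2)^-1 <= 3 / 4 - (M.+2%:R)^-1 :> R.
Proof.
elim: M => [|M IH].
  by rewrite big_nat1; lra.
rewrite big_nat_recr //=; apply: le_trans (lerD IH (lexx _)) _.
rewrite -(natr1 M.+2); set x : R := M.+2%:R.
have x0 : 0 < x by rewrite ltr0n.
rewrite -addrA lerD2l -subr_ge0.
have -> : - (x + 1)^-1 - (- x^-1 + ((x + 1) ^+ 2)^-1) = (x * (x + 1) ^+ 2)^-1.
  by field; rewrite !gt_eqF // addr_gt0.
by rewrite invr_ge0 mulr_ge0 ?exprn_ge0 ?addr_ge0 // ltW.
Qed.

Lemma sum_natr_divn_sqr_le (R : realFieldType) (M : nat) :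
  4 * \sum_(2 <= d < M.+3) (M.+2 %/ d)%:R ^+ 2 <= 3 * M.+2%:R ^+ 2 :> R.
Proof.
apply: (@le_trans _ _ (4 * (M.+2%:R ^+ 2 * \sum_(2 <= d < M.+3) (d%:R ^+ 2)^-1))).
  rewrite ler_wpM2l // mulr_sumr; apply: ler_sum_nat => d /andP[d2 _].
  have d0 : 0 < d%:R :> R by rewrite ltr0n ltnW.
  rewrite -exprVn -exprMn lerXn2r ?nnegrE ?divr_ge0 //.
  by rewrite ler_pdivlMr // -natrM ler_nat leq_trunc_div.
have := sum_inv_sqr_le R M; set s := \sum_(_ <= _ < _) _ => sle.
have sl : s <= 3 / 4.
  by apply: le_trans sle _; rewrite gerBl invr_ge0.
rewrite mulrCA [leRHS]mulrC ler_wpM2l ?sqr_ge0 //.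
by move: sl; clear; lra.
Qed.

Lemma sum_divn_sqr_le (M : nat) :
  (4 * \sum_(2 <= d < M.+1) (M %/ d) ^ 2 <= 3 * M ^ 2)%N.
Proof.
case: M => [|[|M]]; [by rewrite big_geq | by rewrite big_geq | ].
rewrite -(@ler_nat rat) [leLHS]natrM [leRHS]natrM natr_sum natrX.
under eq_bigr do rewrite natrX.
exact: sum_natr_divn_sqr_le.
Qed.

Lemma card_dvdn_ord (M d : nat) : #|[pred j : 'I_M | (d %| j.+1)%N]| = (M %/ d)%N.
Proof.
rewrite divn_count_dvd big_add1 /= big_mkord -sum1_card big_mkcond.
by apply: eq_bigr => i _; rewrite inE; case: (_ %| _)%N.
Qed.

(** Union bound: if the gcd d is not 1, then 2 <= d <= M because the entries lie in 1..M, and d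
    divides every entry. These vectors make up at most 3/4 of the box. *)
Lemma card_primitive_box (n M : nat) : (2 <= n)%N -> (1 <= M)%N ->
  (M ^ n <= 4 * #|[set t : {ffun 'I_n -> 'I_M} |
     \big[gcdn/0%N]_(i < n) (t i).+1 == 1%N]%SET|)%N.
Proof.
move=> n2 M1; set P := [set _ | _]%SET.
pose B (d : 'I_M.+1) := [set t : {ffun 'I_n -> 'I_M} | t \in ffun_on [pred j : 'I_M | (d %| j.+1)%N]]%SET.
have NP : ~: P \subset (\bigcup_(d : 'I_M.+1 | (2 <= d)%N) B d)%SET.
  apply/fintype.subsetP => t; rewrite !inE; set g := \big[_/_]_(_ < _) _ => g1.
  have gdvd i : (g %| (t i).+1)%N.
    by have /dvdn_biggcdP := dvdnn g; exact.
  pose i0 : 'I_n := Ordinal (ltnW n2).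
  have gM : (g < M.+1)%N.
    by rewrite ltnS (leq_trans (dvdn_leq _ (gdvd i0))).
  have g0 : (0 < g)%N by apply: dvdn_gt0 (gdvd i0).
  apply/bigcupP; exists (Ordinal gM) => /=; first by rewrite ltn_neqAle eq_sym g1.
  by rewrite inE; apply/ffun_onP => i; rewrite inE.
have cNP : (4 * #|~: P| <= 3 * M ^ n)%N.
  (* There are [(M %/ d) ^ n] vectors divisible by d; as n >= 2, all but two factors may be bounded
     by M, which reduces to a sum of squares. *)
  apply: (@leq_trans (4 * \sum_(2 <= d < M.+1) M ^ (n - 2) * (M %/ d) ^ 2)%N).
    rewrite leq_mul2l /=; apply: leq_trans (subset_leq_card NP) _.
    apply: leq_trans (unstable.card_big_setU _ _ _) _.
    rewrite (big_nat_widenl 2 0) // big_mkord.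
    rewrite [leqRHS](eq_bigl (fun d : 'I_M.+1 => (2 <= d)%N)); last first.
      by by move=> d.
    apply: leq_sum => d d2.
    rewrite cardsE card_ffun_on card_dvdn_ord card_ord.
    rewrite -{1}(subnK n2) expnD leq_mul2r.
    by case: (n - 2)%N => [|k]; rewrite ?expn0 ?orbT // leq_exp2r // leq_div orbT.
  rewrite -big_distrr /= mulnCA -{2}(subnK n2) expnD [leqRHS]mulnCA.
  by rewrite leq_mul2l sum_divn_sqr_le orbT.
have : (#|P| + #|~: P|)%N = (M ^ n)%N by rewrite cardsC card_ffun !card_ord.
lia.
Qed.

(** * Generic vectors and the norm of their minimal solutions *)

Lemma height_le_enorm (R : realType) (n : nat) (v : 'rV[int]_n) :
  (height v)%:R <= enorm (toR R v).
Proof.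
rewrite /height; elim/big_ind: _ => [|x y|i _]; first exact: sqrtr_ge0.
  by rewrite /maxn; case: ifP.
rewrite enorm_toR -[leLHS]ger0_norm // -sqrtr_sqr ler_wsqrtr // -natrX ler_nat.
by rewrite (bigD1 i) //= leq_addr.
Qed.

Lemma enorm_le (R : realType) (n : nat) (v : 'rV[int]_n) (b : R) :
  0 <= b -> (forall i, `|v 0 i|%:~R <= b) -> enorm (toR R v) <= n%:R * b.
Proof.
move=> b0 vb; have nb0 : 0 <= n%:R * b by rewrite mulr_ge0.
rewrite -[leRHS]ger0_norm // -sqrtr_sqr ler_wsqrtr //.
apply: (@le_trans _ _ (\sum_(i < n) b ^+ 2)).
  apply: ler_sum => i _; rewrite mxE -[leLHS]real_normK ?num_real //.
  by rewrite lerXn2r ?nnegrE // -intr_norm.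
rewrite sumr_const card_ord exprMn -[leLHS]mulr_natl ler_wpM2r ?sqr_ge0 //.
by rewrite -natrX ler_nat; case: n {v vb nb0} => // n; rewrite -mulnn leq_pmulr.
Qed.

Lemma enorm_le_height (R : realType) (n : nat) (v : 'rV[int]_n) :
  enorm (toR R v) <= n%:R * (height v)%:R.
Proof.
by apply: enorm_le => // i; rewrite -[leRHS]/((height v)%:Z%:~R) ler_int ler_height.
Qed.

(** The set A of the theorem, with the 2n-th root cleared. The exponent makes relation heights grow
    with v, yet keeps exceptions rare: D^(2n) <= N gives D^n N^(n-1) <= N^(n-1/2). *)
Definition generic (n : nat) : set 'rV[int]_n :=
  [set v | primitive v /\ forall u, u != 0 -> relation v u ->
     (height v <= height u ^ (2 * n))%N].

(** Every nonzero relation of v has height above K, so the minimal solution is no longer than the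
    rounded one. Its norm divided by V is at most n/V + 4n^2/K, and K <= V. *)
Lemma minsol_generic_le (R : realType) (n : nat) (v : 'rV[int]_n) (K : nat) :
  (3 <= n)%N -> generic n v -> (0 < K)%N -> (K ^ (2 * n) < height v)%N ->
  enorm (toR R (minsol R v)) / enorm (toR R v) <= (n + 4 * n ^ 2)%:R / K%:R.
Proof.
move=> n3 [pv gv] K0 KV; set V := height v in KV.
have n0 : (0 < n)%N by apply: leq_trans n3.
have [vw wmin] := minsolP R pv.
have [u u0 vu|x [vx xK]] := short_solution n v (minsol R v) K n3 vw.
  rewrite -(@ltn_exp2r _ _ (2 * n)) ?muln_gt0 ?n0 //.
  exact: leq_trans KV (gv u u0 vu).
have K0' : 0 < K%:R :> R by rewrite ltr0n.
have V0 : 0 < V%:R :> R by rewrite ltr0n (leq_ltn_trans _ KV).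
have VK : K%:R <= V%:R :> R.
  rewrite ler_nat (leq_trans _ (ltnW KV)) // -[leqLHS]expn1 leq_pexp2l //.
  by rewrite muln_gt0.
have xle : enorm (toR R x) <= n%:R * ((K%:R + 4 * n%:R * V%:R) / K%:R).
  apply: enorm_le => [|i].
    by rewrite divr_ge0 // addr_ge0 // mulr_ge0.
  rewrite ler_pdivlMr // mulrC.
  by have := xK i; rewrite -(ler_int R) !(intrM, intrD).
apply: (@le_trans _ _ (n%:R * ((K%:R + 4 * n%:R * V%:R) / K%:R) / V%:R)).
  apply: ler_pM; rewrite ?sqrtr_ge0 ?invr_ge0 ?sqrtr_ge0 //.
    exact: le_trans (wmin _ vx) xle.
  by rewrite lef_pV2 ?posrE ?height_le_enorm // (lt_le_trans V0) ?height_le_enorm.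
rewrite ler_pdivrMr // [leRHS]mulrAC ler_pdivlMr // -[leLHS]mulrA divfK ?gt_eqF //.
rewrite natrD natrM natrX; have := ler_wpM2l (ler0n R n) VK.
by clear; nra.
Qed.

(** * Density of the generic vectors among the primitive ones *)

Lemma primitive_card_ball_ge (R : realType) (n M : nat) (r : R) :
  (2 <= n)%N -> (1 <= M)%N -> (n * M)%:R <= r ->
  (M ^ n <= 4 * card_ball (@primitive n) r)%N.
Proof.
move=> n2 M1 nMr; apply: leq_trans (card_primitive_box n M n2 M1) _.
rewrite leq_mul2l /=; apply: (leq_card_fset_set_inj _ _ _ (pos_row n M)).
- by apply: finite_setIr; exact: finite_ball.
- exact: pos_row_inj.
move=> t; rewrite inE => /eqP gt; split.
  by apply: etrans gt; apply: eq_bigr => i _; rewrite mxE.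
rewrite /= /ball_origin /=; apply: le_trans nMr; rewrite natrM.
by apply: enorm_le => // i; rewrite mxE -[leRHS]/(M%:Z%:~R) ler_int ger0_norm // lez_nat ltn_ord.
Qed.

Lemma exists_root (N e : nat) : (0 < e)%N ->
  exists D, (D ^ e <= N < D.+1 ^ e)%N.
Proof.
move=> e0; elim: N => [|N [D /andP[DN ND]]].
  by exists 0%N; rewrite exp0n // exp1n.
have [lt|ge] := ltnP N.+1 (D.+1 ^ e); first by exists D; rewrite lt (leq_trans DN).
exists D.+1; rewrite ge /=.
by apply: (@leq_ltn_trans (D.+1 ^ e)); rewrite // ltn_exp2r.
Qed.

(** A primitive v of the ball that is not generic has a relation u with height(u)^(2n) < height(v)
    <= N < (D+1)^(2n), hence of height at most D, and [card_related] counts such v. *)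
Lemma card_ball_generic_defect (R : realType) (n N D : nat) (r : R) :
  N = Num.truncn r -> 0 <= r -> (N < D.+1 ^ (2 * n))%N -> (0 < n)%N ->
  (card_ball (@primitive n) r <=
     card_ball (generic n) r + (D + D).+1 ^ n * (N + N).+1 ^ n.-1)%N.
Proof.
move=> NE r0 ND n0.
have fin A : finite_set (A `&` toR R (n:=n) @^-1` ball_origin r).
  by apply: finite_setIr; exact: finite_ball.
pose S := (@primitive n `\` generic n) `&` toR R (n:=n) @^-1` ball_origin r.
have -> : card_ball (@primitive n) r =
    #|` fset_set ((generic n `&` toR R (n:=n) @^-1` ball_origin r) `|` S)|%fset.
  congr (#|` fset_set _|%fset); rewrite -setIUl; congr (_ `&` _).
  by rewrite setDUK // => v [].
rewrite fset_setU //; last exact: fin.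
rewrite cardfsU (leq_trans (leq_subr _ _)) // leq_add2l.
apply: card_related; first exact: fin.
move=> v [[pv ngv] vr].
have vN : (height v <= N)%N.
  by rewrite NE truncn_ge_nat // (le_trans (height_le_enorm R n v)).
split=> //; apply: contrapT => /forallNP nrel; apply: ngv; split=> // u u0 vu.
apply: (leq_trans vN); rewrite leqNgt; apply/negP => uN; apply: (nrel u); split => //.
rewrite -ltnS -(@ltn_exp2r _ _ (2 * n)) ?muln_gt0 ?n0 //.
exact: ltn_trans ND.
Qed.

(** D is the integer 2n-th root of N, the integer part of r. The threshold n on r makes M positive,
    so that M^n/4 bounds the primitive count from below; the threshold K^(2n) gives K <= D. *)
Lemma generic_ratio (R : realType) (n K : nat) (r : R) :
  (3 <= n)%N -> (0 < K)%N -> (maxn n (K ^ (2 * n)))%:R <= r ->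
  `|1 - (card_ball (generic n) r)%:R / (card_ball (@primitive n) r)%:R|
     <= (4 * (18 * n) ^ n)%:R / K%:R :> R.
Proof.
move=> n3 K0 rK.
have r0 : 0 <= r by apply: le_trans rK.
pose N := Num.truncn r; pose M := (N %/ n)%N.
have n0 : (0 < n)%N by apply: leq_trans n3.
have /andP[nN KN] : ((n <= N) && (K ^ (2 * n) <= N))%N.
  by rewrite -geq_max truncn_ge_nat.
have M1 : (1 <= M)%N by rewrite divn_gt0.
have [D /andP[DN ND]] := exists_root N (2 * n) (leq_trans n0 (leq_pmull n (isT : (0 < 2)%N))).
have KD : (K <= D)%N.
  by rewrite -ltnS -(@ltn_exp2r _ _ (2 * n)) ?muln_gt0 ?n0 // (leq_ltn_trans KN).
have pM := primitive_card_ball_ge R n M r (ltnW n3) M1.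
have pg := card_ball_generic_defect R n N D r erefl r0 ND n0.
have {}pM : (M ^ n <= 4 * card_ball (@primitive n) r)%N.
  apply: pM; rewrite -truncn_ge_nat // mulnC; exact: leq_trunc_div.
set p := card_ball (@primitive n) r in pM pg *.
set g := card_ball (generic n) r in pg *.
have gp : (g <= p)%N.
  rewrite /g /p /card_ball; apply: fsubset_leq_card.
  have fin A : finite_set (A `&` toR R (n:=n) @^-1` ball_origin r).
    by apply: finite_setIr; exact: finite_ball.
  by rewrite -fset_set_sub //; apply: setSI => v [].
have p0 : (0 < p)%N.
  have : (0 < M ^ n)%N by rewrite expn_gt0 M1.
  by move/leq_trans => /(_ _ pM); rewrite muln_gt0.
have N0 : (0 < N)%N by apply: leq_trans nN.
have D0 : (0 < D)%N by apply: leq_trans KD.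
have NM : (N <= 2 * n * M)%N.
  have : (N < n * M.+1)%N by rewrite mulnC ltn_ceil.
  rewrite mulnS; have : (n <= n * M)%N by rewrite leq_pmulr.
  rewrite -mulnA; lia.
(* K(p - g) <= D (3D)^n (3N)^(n-1) <= 9^n N^n <= (18n)^n M^n, by D^(n+1) <= N and N <= 2nM. *)
have key : (K * (p - g) <= 4 * (18 * n) ^ n * p)%N.
  apply: (@leq_trans (D * ((3 * D) ^ n * (3 * N) ^ n.-1))).
    apply: leq_mul => //; rewrite leq_subLR (leq_trans pg) // leq_add2l.
    by apply: leq_mul; rewrite leq_exp2r; lia.
  have DDN : (D * D ^ n <= N)%N.
    by rewrite -expnS (leq_trans _ DN) // leq_pexp2l //; lia.
  rewrite !expnMn.
  apply: (@leq_trans (3 ^ n * 3 ^ n * (N * N ^ n.-1))).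
    have -> : (D * (3 ^ n * D ^ n * (3 ^ n.-1 * N ^ n.-1)) =
               3 ^ n * 3 ^ n.-1 * (D * D ^ n * N ^ n.-1))%N by ring.
    by rewrite leq_mul ?leq_mul // leq_pexp2l // leq_pred.
  rewrite -expnS prednK // -!expnMn.
  apply: (@leq_trans ((3 * 3 * (2 * n * M)) ^ n)).
    by rewrite leq_exp2r // leq_mul2l NM.
  have -> : (3 * 3 * (2 * n * M) = 18 * n * M)%N by ring.
  by rewrite expnMn -mulnA mulnCA leq_mul2l pM orbT.
have pR : 0 < p%:R :> R by rewrite ltr0n.
have -> : 1 - g%:R / p%:R = (p - g)%:R / p%:R :> R.
  by rewrite natrB // mulrBl divff ?gt_eqF.
rewrite ger0_norm ?divr_ge0 // ler_pdivrMr // mulrAC ler_pdivlMr ?ltr0n //.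
by rewrite -!natrM ler_nat mulnC.
Qed.

(** * Passage to the two limits *)

Lemma exists_ratio_le (R : realType) (c : nat) (e : R) : 0 < e ->
  exists2 K, (0 < K)%N & c%:R / K%:R <= e.
Proof.
move=> e0; exists (Num.truncn (c%:R / e)).+1 => //.
by rewrite ler_pdivrMr // mulrC -ler_pdivrMr // ltW // truncnS_gt.
Qed.

Theorem theoremA (R : realType) (n : nat) (hn : (3 <= n)%N) :
  exists A : set 'rV[int]_n,
    [/\ A `<=` @primitive n,
        (card_ball A r)%:R / (card_ball (@primitive n) r)%:R @[r --> (+oo : set_system R)]
          --> (1 : R)
      & forall v : nat -> 'rV[int]_n,
          (forall m, A (v m)) ->
          enorm (toR R (v m)) @[m --> \oo] --> +oo ->
          enorm (toR R (minsol R (v m))) / enorm (toR R (v m)) @[m --> \oo]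
            --> (0 : R)].
Proof.
exists (generic n); split; first by move=> v [].
  apply/cvgrPdist_le => e e0.
  have [K K0 Ke] := exists_ratio_le R (4 * (18 * n) ^ n) e e0.
  have := nbhs_pinfty_ge (num_real (maxn n (K ^ (2 * n)))%:R : _ \is @Num.real R).
  by apply: filterS => r rK; apply: le_trans Ke; exact: generic_ratio.
move=> v gv /cvgryPge vy; apply/cvgr0Pnorm_le => e e0.
have [K K0 Ke] := exists_ratio_le R (n + 4 * n ^ 2) e e0.
(* The norm is at most n times the height, so this threshold forces the height above K^(2n). *)
have := vy (n * (K ^ (2 * n)).+1)%:R; apply: filterS => m vm.
rewrite ger0_norm ?divr_ge0 ?sqrtr_ge0 //; apply: le_trans Ke.
apply: minsol_generic_le => //.
have := le_trans vm (enorm_le_height R n (v m)).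
by rewrite -natrM ler_nat leq_mul2l -leqn0 leqNgt (leq_trans _ hn).
Qed.
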